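(* Let $\mathcal{A}$ and $\mathcal{B}$ be almost bounded structures. If $\mathcal{A}\equiv\mathcal{B}$, then $\Lambda(\mathcal{A}^{\mathfrak{ue}})=\Lambda(\mathcal{B}^{\mathfrak{ue}})$.
   Context: All structures are of the form $\mathcal{A}=\langle A,R\rangle$ with a single binary relation $R\subseteq A\times A$; $\equiv$ is first-order elementary equivalence. $\mathcal{A}$ is bounded if there is a finite number that bounds the in-degree and out-degree of every node of $\mathcal{A}$. $\mathcal{A}$ is almost bounded if, except for finitely many nodes with infinite degree (infinitely many $R$-successors or infinitely many $R$-predecessors), $\mathcal{A}$ is bounded; i.e. only finitely many nodes have infinite degree and there is a finite bound on the in- and out-degrees of all the other nodes. The ultrafilter extension of $\mathcal{A}$ is $\mathcal{A}^{\mathfrak{ue}}=\langle \mathrm{Uf}(A),R^{\mathfrak{ue}}\rangle$, where $\mathrm{Uf}(A)$ is the set of all ultrafilters over $A$ and $R^{\mathfrak{ue}}(u,v)$ holds iff $\{R[X]:X\in u\}\subseteq v$ (equivalently $\{\langle R\rangle(X):X\in v\}\subseteq u$), with $R[X]=\{s:(\exists w\in X)\,R(w,s)\}$ and $\langle R\rangle(X)=\{w:(\exists s\in X)\,R(w,s)\}$. Basic modal formulas (propositional variables from a set $\mathsf{Prop}$, Boolean connectives, one unary $\diamondsuit$) are interpreted in a structure in the usual Kripke way: for a valuation $V:\mathsf{Prop}\to\mathcal{P}(A)$, $\diamondsuit\varphi$ is true at $w$ iff $\varphi$ is true at some $v$ with $R(w,v)$. $\mathcal{A}\Vdash\varphi$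 means that $\varphi$ is true at every $w\in A$ under every valuation $V$, and $\Lambda(\mathcal{A})=\{\varphi:\mathcal{A}\Vdash\varphi\}$. *)

(* Defs.v *)
From mathcomp Require Import all_boot.
From mathcomp Require Import boolp classical_sets functions cardinality filter.

Set Implicit Arguments.
Unset Strict Implicit.
Unset Printing Implicit Defensive.

Local Open Scope classical_set_scope.
Local Open Scope card_scope.

(* The empty structure is not excluded. *)
Record structure := Structure {
  carrier :> Type;
  edge : carrier -> carrier -> Prop
}.

Definition successors (A : structure) (x : A) : set A := [set y | edge x y].

Definition predecessors (A : structure) (x : A) : set A := [set y | edge y x].

Definition infinite_degree (A : structure) : set A :=
  [set x | infinite_set (successors x) \/ infinite_set (predecessors x)].

Definition almost_bounded (A : structure) : Prop :=
  finite_set (@infinite_degree A) /\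
  exists n : nat, forall x : A, ~ infinite_degree x ->
    successors x #<= `I_n /\ predecessors x #<= `I_n.

(* First-order formulas with equality, with free variables among 'I_n; a
   sentence has none. In [FEx f], the bound variable of [f] is [ord0] and
   [lift ord0 i] stands for the outer variable [i]. Well-scoping keeps the
   satisfaction of sentences meaningful in the empty structure, where there is
   no assignment of infinitely many variables. *)
Inductive fo_formula : nat -> Type :=
| FEq n : 'I_n -> 'I_n -> fo_formula n
| FEdge n : 'I_n -> 'I_n -> fo_formula n
| FNeg n : fo_formula n -> fo_formula n
| FAnd n : fo_formula n -> fo_formula n -> fo_formula n
| FEx n : fo_formula n.+1 -> fo_formula n.

Definition extend_env (T : Type) n (a : T) (e : 'I_n -> T) (i : 'I_n.+1) : T :=
  oapp e a (unlift ord0 i).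

Fixpoint fo_sat (A : structure) n (f : fo_formula n) : ('I_n -> A) -> Prop :=
  match f with
  | FEq _ i j => fun e => e i = e j
  | FEdge _ i j => fun e => edge (e i) (e j)
  | FNeg _ g => fun e => ~ fo_sat g e
  | FAnd _ g h => fun e => fo_sat g e /\ fo_sat h e
  | FEx _ g => fun e => exists a : A, fo_sat g (extend_env a e)
  end.

Definition empty_env (T : Type) : 'I_0 -> T :=
  fun i => False_rect T (notF (ltn_ord i)).

Definition fo_sentence := fo_formula 0.

Definition fo_true (A : structure) (s : fo_sentence) : Prop :=
  fo_sat s (@empty_env A).

Definition elementarily_equivalent (A B : structure) : Prop :=
  forall s : fo_sentence, fo_true A s <-> fo_true B s.

Definition rel_image (A : structure) (X : set A) : set A :=
  [set s | exists2 w, X w & edge w s].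

Definition Uf (T : Type) : Type := {u : set_system T | UltraFilter u}.

Definition ultrafilter_extension (A : structure) : structure :=
  {| carrier := Uf A;
     edge := fun u v => @rel_image A @` sval u `<=` sval v |}.

(* The remaining Boolean connectives are definable from these. *)
Inductive modal_formula (P : Type) : Type :=
| MVar : P -> modal_formula P
| MBot : modal_formula P
| MNeg : modal_formula P -> modal_formula P
| MOr : modal_formula P -> modal_formula P -> modal_formula P
| MDia : modal_formula P -> modal_formula P.

Arguments MBot {P}.

Fixpoint modal_true (P : Type) (A : structure) (V : P -> set A) (w : A)
    (phi : modal_formula P) : Prop :=
  match phi with
  | MVar p => V p w
  | MBot => False
  | MNeg psi => ~ modal_true V w psi
  | MOr psi chi => modal_true V w psi \/ modal_true V w chi
  | MDia psi => exists2 v : A, edge w v & modal_true V v psi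
  end.

Definition modal_valid (P : Type) (A : structure) (phi : modal_formula P) :
    Prop :=
  forall (V : P -> set A) (w : A), modal_true V w phi.

Definition modal_logic (P : Type) (A : structure) : set (modal_formula P) :=
  [set phi | modal_valid A phi].

Arguments modal_logic : clear implicits.

(* Main.v *)
Require Import Defs.
From mathcomp Require Import all_boot.
From mathcomp Require Import boolp classical_sets functions cardinality filter.

(** Validity over an ultrafilter extension quantifies over all valuations, so it
    is not a first-order matter, and elementary equivalence of the two
    extensions would not settle it; what has to be transferred is a valuation.
    A refutation of a formula over the ultrafilter extension of [A] is recorded
    by labelling each ultrafilter with the truth values of the finitely many
    subformulas [psi] and of the formulas [MDia psi]. Such a labelling is
    [coherent]: the bit of [MDia psi] is set exactly at the points having a
    successor whose bit for [psi] is set. Conversely, a coherent labelling with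
    the same labels over the extension of [B] defines a valuation there that
    realizes the recorded truth values ([valid_transfer]). So the theorem
    reduces to carrying a coherent labelling from [A] to [B] while keeping one
    prescribed label ([coherent_transfer]).

    Coherence is local, except for the points with infinitely many successors,
    where it can ask for a witness at any distance. There are finitely many such
    points, all of them principal, so finitely many pins suffice: the point
    whose label is to be kept, the points of large out-degree, and a witness for
    each of their diamonds. The tuple of pins then leaves a first-order trace:
    for each [m] there is a tuple [x] of points which carries the labels of the
    pins and such that any [m] further points can be labelled consistently with
    it ([extendible]).

    From the extension to the structure ([extendible_ex]). Let [W] be an
    ultrafilter on tuples of points that projects to the pins. A function [y]
    from tuples to points is sent to the ultrafilter [push y W], and labelling
    [y] by the label of this ultrafilter is consistent at almost every tuple:
    this is the classical map of an ultrapower onto the ultrafilter extension,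
    stated without forming the ultrapower. Hence [extendible] holds in [A], and
    then in [B].

    From the structure to the extension ([coherent_ex]). For each [m], choose in
    [B] a tuple that is extendible by [m] points. Along an infinite set of
    indices, each coordinate of these tuples is constant or injective, and the
    new pins are the limits of the coordinates along a nonprincipal ultrafilter.
    By compactness ([finite_labelling_limit]) it is enough to label each finite
    set [F] of ultrafilters, and for this [F] is mapped into [B] so that edges
    are preserved, pins go to the entries of one of the chosen tuples, and
    points all of whose successors lie in [F] go to points whose successors are
    images of successors ([bounded_morphism_approximation]). This is where
    bounded degree is used. Edges between nonprincipal ultrafilters are graphs
    of almost everywhere injective functions ([ue_edge_function]), and two such
    functions with the same image ultrafilter agree almost everywhere
    ([push_inj_ae]). So all the ultrafilters in one Rudin-Keisler class can be
    evaluated simultaneously at one generic index, and there are no edges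
    between different classes of nonprincipal ultrafilters. *)

Set Implicit Arguments.
Unset Strict Implicit.
Unset Printing Implicit Defensive.

Local Open Scope classical_set_scope.
Local Open Scope card_scope.

(** * Finite sets and sequences *)

Lemma bound_subsingleton (X : Type) (x0 : X) (P : set X) :
  (forall y z, P y -> P z -> y = z) -> exists z, forall y, P y -> y = z.
Proof.
move=> H; have [[z Pz]|nP] := pselect (exists z, P z).
  by exists z => y Py; exact: H.
by exists x0 => y Py; case: nP; exists y.
Qed.

Lemma finite_enum (X : Type) (F : set X) : finite_set F ->
  exists n (g : 'I_n -> X), forall x, F x <-> exists i, g i = x.
Proof.
move=> /(@finite_seqP {classic X}) [s ->].
exists (size s), (tnth (in_tuple s)) => x; split=> /=.
  by move=> xs; have /tnthP [i ->] : x \in in_tuple s by []; exists i.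
by case=> i <-; exact: mem_tnth.
Qed.

Lemma card_le_enum (T : Type) (x0 : T) (A : set T) n :
  A #<= `I_n -> exists s : 'I_n -> T, forall y, A y -> exists i, y = s i.
Proof.
move=> /pcard_leP [f].
have /choice [s sP] : forall i : 'I_n, exists z, forall y, A y /\ f y = i -> y = z.
  move=> i; apply: bound_subsingleton => // y z [Ay fy] [Az fz].
  by apply: (@inj _ _ _ f); rewrite ?inE //; exact: (etrans fy (esym fz)).
exists s => y Ay.
have fy : (f y < n)%N by exact: (@funS _ _ _ _ f).
by exists (Ordinal fy); apply: sP.
Qed.

(** If all fibres over [E] are finite, the first occurrences of the values form
    an infinite set on which [x] is injective. *)
Lemma infinite_const_or_inj (T : Type) (x : nat -> T) (E : set nat) :
  infinite_set E -> exists E', [/\ E' `<=` E, infinite_set E' &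
    (exists v, forall a, E' a -> x a = v) \/
    (forall a b, E' a -> E' b -> x a = x b -> a = b)].
Proof.
move=> Einf.
have [[v Ev]|nv] := pselect (exists v, infinite_set (E `&` [set a | x a = v])).
  exists (E `&` [set a | x a = v]); split=> //.
  by left; exists v => a [].
pose E' : set nat := [set a | E a /\ forall b, E b -> x b = x a -> a <= b].
exists E'; split; first by move=> a [].
  move=> E'fin; apply: Einf.
  apply: (@sub_finite_set _ _ (\bigcup_(a in E') (E `&` [set b | x b = x a]))).
    move=> b Eb.
    have exa : exists a, `[< E a /\ x a = x b >] by exists b; apply/asboolP.
    case: (ex_minnP exa) => a /asboolP [Ea ab] amin.
    exists a; last by split.
    by split=> // c Ec ca; apply: amin; apply/asboolP; split=> //; rewrite ca.
  apply: bigcup_finite => // a _; apply: contrapT => inf; apply: nv.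
  by exists (x a).
right=> a b [Ea amin] [Eb bmin] ab; apply/eqP.
by rewrite eqn_leq amin // bmin.
Qed.

Lemma infinite_const_or_inj_family (T : Type) k (x : 'I_k -> nat -> T) :
  exists2 E : set nat, infinite_set E & forall i,
    (exists v, forall a, E a -> x i a = v) \/
    (forall a b, E a -> E b -> x i a = x i b -> a = b).
Proof.
have H (s : seq 'I_k) : exists2 E : set nat, infinite_set E & forall i, i \in s ->
    (exists v, forall a, E a -> x i a = v) \/
    (forall a b, E a -> E b -> x i a = x i b -> a = b).
  elim: s => [|i s [E Einf EP]]; first by exists setT => //; exact: infinite_nat.
  have [E' [E'E E'inf E'P]] := infinite_const_or_inj (x i) Einf.
  exists E' => // j; rewrite inE => /predU1P [->|js] //.
  case: (EP j js) => [[v vP]|injE]; first by left; exists v => a /E'E; exact: vP.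
  by right=> a b /E'E Ea /E'E Eb; exact: injE.
have [E Einf EP] := H (enum 'I_k).
by exists E => // i; apply: EP; rewrite mem_enum.
Qed.

(** * Ultrafilters and pushforwards *)

Lemma filter_finite_forall (J X : Type) (H : set_system J) (F : set X)
    (P : X -> set J) :
  Filter H -> finite_set F -> (forall x, F x -> H (P x)) ->
  H [set j | forall x, F x -> P x j].
Proof.
move=> HF /finite_enum [n [g gF]] HP.
have : H [set j | forall i, P (g i) j].
  by apply: filter_forall => i; apply: HP; apply/gF; exists i.
by apply: filterS => j Pj x /gF [i <-].
Qed.

#[local] Instance Uf_ultra (T : Type) (u : Uf T) : UltraFilter (sval u) := svalP u.

Section Ultrafilters.
Context {T : Type}.
Implicit Types (u v : Uf T) (X Y : set T).

Lemma Uf_sub_eq u v : sval u `<=` sval v -> u = v.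
Proof.
case: u v => [F FU] [G GU] /= FG; apply: eq_exist.
by rewrite (max_filter (@ultra_proper _ _ GU) FG).
Qed.

Lemma Uf_setC u X : ~ sval u X -> sval u (~` X).
Proof. by case: (in_ultra_setVsetC X (Uf_ultra u)). Qed.

Lemma Uf_ex u X : sval u X -> exists x, X x.
Proof. by move=> uX; exact: (@filter_ex _ (sval u) _ X uX). Qed.

Lemma Uf_disjoint u X Y : sval u X -> sval u Y -> exists x, X x /\ Y x.
Proof. by move=> uX uY; apply: (@Uf_ex u); exact: filterI. Qed.

Lemma Uf_sep u v : u <> v -> exists X, sval u X /\ sval v (~` X).
Proof.
move=> uv; apply: contrapT => H; apply: uv; apply: Uf_sub_eq => X uX.
by apply: contrapT => /Uf_setC vX; apply: H; exists X.
Qed.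

Lemma Uf_fiber (L : finType) u (f : T -> L) :
  exists l, sval u [set x | f x = l].
Proof.
apply: contrapT => H.
have : sval u [set x | forall l, f x <> l].
  apply: filter_forall => l; apply: Uf_setC => ul.
  by apply: H; exists l.
by case/Uf_ex => x /(_ (f x)).
Qed.

Lemma ultra_dichotomy (F : set_system T) :
  ProperFilter F -> (forall X, F X \/ F (~` X)) -> UltraFilter F.
Proof.
move=> FF dich; split=> // G GF FG; apply/seteqP; split=> // X GX.
have [//|/FG GnX] := dich X.
by have [x []] := filter_ex (filterI GX GnX).
Qed.

Lemma Uf_extend (F : set_system T) :
  Filter F -> (forall X, F X -> exists x, X x) ->
  exists u, F `<=` sval u.
Proof.
move=> FF Fex.
have [G [GU FG]] := ultraFilterLemma (Build_ProperFilter_ex Fex FF).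
by exists (exist _ G GU).
Qed.

Definition point_Uf (x : T) : Uf T := exist _ _ (principal_filter_ultra x).

Lemma point_UfE x X : sval (point_Uf x) X <-> X x.
Proof. by split=> /principal_filterP. Qed.

Lemma point_Uf_eq u x : sval u [set x] -> u = point_Uf x.
Proof.
move=> ux; symmetry; apply: Uf_sub_eq => X /point_UfE Xx.
by apply: filterS ux => y ->.
Qed.

Definition principal u := exists x, sval u [set x].

Lemma principalP u : principal u -> exists x, u = point_Uf x.
Proof. by case=> x /point_Uf_eq ->; exists x. Qed.

Lemma principal_point x : principal (point_Uf x).
Proof. by exists x; apply/point_UfE. Qed.

End Ultrafilters.

Lemma Uf_finite_principal (T : Type) (u : Uf T) (F : set T) :
  finite_set F -> sval u F -> exists2 x, F x & u = point_Uf x.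
Proof.
move=> Ffin uF; apply: contrapT => H.
have uN : sval u [set y | forall x, F x -> (~` [set x]) y].
  apply: filter_finite_forall => // x Fx; apply: Uf_setC => ux.
  by apply: H; exists x => //; exact: point_Uf_eq.
by have [x [Fx /(_ x Fx)]] := Uf_disjoint uF uN; apply.
Qed.

Lemma point_Uf_inj (T : Type) : injective (@point_Uf T).
Proof.
move=> x y xy.
by have /point_UfE : sval (point_Uf x) [set y] by rewrite xy; apply/point_UfE.
Qed.

Lemma nonprincipal_ultrafilter_on (T : Type) (E : set T) :
  infinite_set E -> exists2 W : Uf T, sval W E & ~ principal W.
Proof.
move=> Einf; pose F : set_system T := [set S | finite_set (E `\` S)].
have FF : Filter F.
  split; rewrite /F /=.
  - by rewrite setDT.
  - by move=> S S' FS FS'; rewrite /= setDIr finite_setU.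
  - by move=> S S' SS'; apply: sub_finite_set; exact: setDS.
have [|W FW] := @Uf_extend _ F FF.
  move=> S FS; apply: contrapT => nS; apply: Einf.
  by apply: sub_finite_set FS => a Ea; split=> // Sa; apply: nS; exists a.
exists W; first by apply: FW; rewrite /F /= setDv.
move=> [a Wa]; have : sval W (~` [set a]).
  by apply: FW; apply: (sub_finite_set _ (finite_set1 a)) => b [_ /contrapT].
by move=> /(Uf_disjoint Wa) [b [->]]; apply.
Qed.

Section Push.
Context {S T : Type}.
Implicit Types (u : Uf S) (f g : S -> T).

Lemma push_ultra f u : UltraFilter (fmap f (sval u)).
Proof.
apply: ultra_dichotomy.
by move=> X; exact: (in_ultra_setVsetC (f @^-1` X) (Uf_ultra u)).
Qed.

Definition push f u : Uf T := exist _ _ (push_ultra f u).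

Lemma pushE f u X : sval (push f u) X = sval u (f @^-1` X).
Proof. by []. Qed.

Lemma push_ae f g u : sval u [set x | f x = g x] -> push f u = push g u.
Proof.
move=> fg; apply: Uf_sub_eq => X; rewrite !pushE => uX.
by apply: filterS (filterI fg uX) => x /= [<-].
Qed.
End Push.

Lemma push_comp R S T (f : R -> S) (g : S -> T) u :
  push g (push f u) = push (g \o f) u.
Proof. exact: Uf_sub_eq. Qed.

Lemma push_id T (u : Uf T) : push id u = u.
Proof. exact: Uf_sub_eq. Qed.
(** * The edge relation of the ultrafilter extension *)

Section UltrafilterExtension.
Context {M : structure}.
Implicit Types (u v : Uf M) (X Y Z : set M).

Definition dia Z : set M := [set x | exists2 y, edge x y & Z y].

(** The dual description of the edge relation, by preimages instead of images. *)
Definition ue_edge u v : Prop := forall Y, sval v Y -> sval u (dia Y).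

Lemma ue_edgeP u v : @edge (ultrafilter_extension M) u v <-> ue_edge u v.
Proof.
split=> [uv Y vY|uv _ [X uX <-]].
  apply: contrapT => /Uf_setC uY.
  have vR : sval v (rel_image (~` dia Y)) by apply: uv; exists (~` dia Y).
  have [y [[x xY xy] Yy]] := Uf_disjoint vR vY.
  by apply: xY; exists y.
apply: contrapT => /Uf_setC /uv uY.
have [x [Xx [y xy]]] := Uf_disjoint uX uY.
by apply; exists x.
Qed.

(** Any [v] extending the filter of the sets [Y] such that, for almost every
    [x], all successors of [x] in [Z] lie in [Y]. *)
Lemma ue_edge_ex u Z : sval u (dia Z) -> exists2 v, ue_edge u v & sval v Z.
Proof.
move=> uZ; pose F : set_system M :=
  [set Y | sval u [set x | forall y, edge x y -> Z y -> Y y]].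
have FF : Filter F.
  split; rewrite /F /=; first by apply: filterS filterT => x _ y.
    move=> Y Y' FY FY'; apply: filterS (@filterI _ (sval u) _ _ _ FY FY') => x [xY xY'] y xy Zy.
    by split; [exact: xY|exact: xY'].
  by move=> Y Y' YY'; apply: filterS => x H y xy Zy; apply: YY'; exact: H.
have [|v Fv] := @Uf_extend _ F FF.
  by move=> Y FY; have [x [[y xy Zy] /(_ y xy Zy)]] := Uf_disjoint uZ FY; exists y.
exists v; last by apply: Fv; rewrite /F /=; apply: filterS filterT => x _ y.
move=> Y vY; apply: contrapT => /Uf_setC uY.
have /Fv vnY : F (~` Y).
  by rewrite /F /=; apply: filterS uY => x nxY y xy _ Yy; apply: nxY; exists y.
by have [y []] := Uf_disjoint vY vnY.
Qed.

Lemma ue_edge_pointl x v : ue_edge (point_Uf x) v <-> sval v (successors x).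
Proof.
split=> [xv|vx Y vY].
  by apply: contrapT => /Uf_setC /xv /point_UfE [y xy]; apply.
by apply/point_UfE; have [y [xy Yy]] := Uf_disjoint vx vY; exists y.
Qed.

Lemma ue_edge_pointr u y : ue_edge u (point_Uf y) <-> sval u (predecessors y).
Proof.
split=> [uy|uy Y /point_UfE Yy]; last by apply: filterS uy => x xy; exists y.
have /uy : sval (point_Uf y) [set y] by apply/point_UfE.
by apply: filterS => x [z xz <-].
Qed.

End UltrafilterExtension.

Lemma ue_edge_push (M : structure) (J : Type) (f g : J -> M) (W : Uf J) :
  sval W [set j | edge (f j) (g j)] -> ue_edge (push f W) (push g W).
Proof.
move=> fg Y gY; rewrite pushE; apply: filterS (filterI fg gY) => j [fgj Yj].
by exists (g j).
Qed.

(** * Compactness and finite colourings *)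

(** Rado's selection principle: the limit of the labellings [lam G] along an
    ultrafilter on finite sets that contains, for each finite [F], the set of
    all [G] including [F]. *)
Lemma finite_labelling_limit (X : Type) (L : finType) (lam : set X -> X -> L) :
  exists l : X -> L, forall F, finite_set F ->
    exists G, [/\ finite_set G, F `<=` G & forall x, F x -> lam G x = l x].
Proof.
pose H : set_system (set X) := [set S | exists2 F, finite_set F &
  forall G, finite_set G -> F `<=` G -> S G].
have HF : Filter H.
  split; first by exists set0.
    move=> S S' [F Ffin FS] [F' F'fin F'S]; exists (F `|` F').
      by rewrite finite_setU.
    move=> G Gfin FG; split; first by apply: FS => // x Fx; apply: FG; left.
    by apply: F'S => // x F'x; apply: FG; right.
  by move=> S S' SS' [F Ffin FS]; exists F => // G Gfin FG; apply/SS'/FS.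
have [|U HU] := @Uf_extend _ H HF; first by move=> S [F Ffin FS]; exists F; exact: FS.
have [l lP] := choice (fun x => Uf_fiber U (lam ^~ x)).
exists l => F Ffin.
have /Uf_ex [G [[Gfin FG] GP]] : sval U ([set G | finite_set G /\ F `<=` G] `&`
    [set G | forall x, F x -> lam G x = l x]).
  apply: filterI; first by apply: HU; exists F.
  by apply: filter_finite_forall => // x _; exact: lP.
by exists G.
Qed.

(** Greedy colouring of the finite subgraphs, then compactness. The function [N]
    bounds degrees: the neighbours of [x] are among the values [N x i]. *)
Lemma bounded_coloring (X : Type) (K : finType) (E : X -> X -> Prop)
    (N : X -> K -> X) :
  (forall x y, E x y -> E y x) -> (forall x, ~ E x x) ->
  (forall x y, E x y -> exists i, y = N x i) ->
  exists c : X -> 'I_#|K|.+1, forall x y, E x y -> c x <> c y.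
Proof.
move=> Esym Eirr EN.
have greedy (s : seq {classic X}) : exists c : X -> 'I_#|K|.+1,
    forall x y, x \in s -> y \in s -> E x y -> c x <> c y.
  elim: s => [|x s [c cP]]; first by exists (fun=> ord0).
  have [k kP] : exists k, k \notin codom (fun i => c (N x i)).
    apply: contrapT => H.
    have Ksub : 'I_#|K|.+1 \subset codom (fun i => c (N x i)).
      by apply/fintype.subsetP => k _; apply: contrapT => /negP kP; apply: H; exists k.
    have := leq_trans (subset_leq_card Ksub) (leq_image_card _ _).
    by rewrite card_ord ltnn.
  exists (fun y => if y == x :> {classic X} then k else c y) => y z.
  have kN y' : E x y' -> c y' <> k.
    by move=> /EN [i ->] ck; move/negP: kP; apply; rewrite -ck; exact: codom_f.
  rewrite !inE; case: eqVneq => [->|yx] /=; case: eqVneq => [->|zx] //=.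
  - by move=> _ _ /Eirr.
  - by move=> _ _ /kN ck /esym.
  - by move=> _ _ /Esym /kN.
  - exact: cP.
have /choice [lam lamP] : forall F : set X, exists l : X -> 'I_#|K|.+1,
    finite_set F -> forall x y, F x -> F y -> E x y -> l x <> l y.
  move=> F.
  have [/(@finite_seqP {classic X}) [s ->]|] := pselect (finite_set F); last first.
    by exists (fun=> ord0).
  by have [c cP] := greedy s; exists c.
have [l lP] := finite_labelling_limit lam.
exists l => x y Exy.
have [G [Gfin FG GP]] := lP _ (finite_set2 x y).
rewrite -!GP; [|by right|by left].
by apply: lamP => //; apply: FG; [left|right].
Qed.

(** * Injective pushforwards *)

Definition ae_inj (S T : Type) (u : Uf S) (f : S -> T) : Prop :=
  exists2 X, sval u X & forall x y, X x -> X y -> f x = f y -> x = y.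

(** The two-function form of Katetov's theorem that a map preserving an
    ultrafilter is the identity on a large set. On the set where [f] and [g]
    differ, join [j] to [k] when [f j = g k] or [g j = f k]. Injectivity bounds
    the degrees by 2, so some large set [Y] has a single colour; as [f] and [g]
    have the same image ultrafilter, the preimage under [g] of the image of [Y]
    under [f] meets [Y], which gives an edge inside [Y]. *)
Lemma push_inj_ae (J T : Type) (W : Uf J) (f g : J -> T) :
  ae_inj W f -> ae_inj W g -> push f W = push g W -> sval W [set j | f j = g j].
Proof.
move=> [X1 WX1 fX1] [X2 WX2 gX2] fg; apply: contrapT => /Uf_setC Wfg.
pose X := X1 `&` X2 `&` [set j | f j <> g j].
have WX : sval W X by do !apply: filterI.
have finj x y : X x -> X y -> f x = f y -> x = y by move=> [[? _] _] [[? _] _]; exact: fX1.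
have ginj x y : X x -> X y -> g x = g y -> x = y by move=> [[_ ?] _] [[_ ?] _]; exact: gX2.
have /choice [N1 N1P] : forall j, exists z, forall k, X k /\ f j = g k -> k = z.
  move=> j.
  by apply: bound_subsingleton => // k k' [Xk ->] [Xk' /ginj]; exact.
have /choice [N2 N2P] : forall j, exists z, forall k, X k /\ g j = f k -> k = z.
  move=> j.
  by apply: bound_subsingleton => // k k' [Xk ->] [Xk' /finj]; exact.
pose E j k := [/\ X j, X k & f j = g k \/ g j = f k].
have [|||c cP] := @bounded_coloring J bool E (fun j b => if b then N1 j else N2 j).
- by move=> j k [Xj Xk [H|H]]; split=> //; [right|left].
- by move=> j [[_ fgj] _ [|/esym]].
- by move=> j k [Xj Xk [H|H]]; [exists true; apply: N1P|exists false; apply: N2P].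
have [l Wl] := Uf_fiber W c.
pose Y := X `&` [set j | c j = l].
have WY : sval W Y by apply: filterI.
have : sval (push g W) (f @` Y).
  by rewrite -fg pushE; apply: filterS WY => j Yj; exists j.
rewrite pushE => WgY.
have [j [[Xj cj] [k [Xk ck] fk]]] := Uf_disjoint WY WgY.
have /cP : E k j by split=> //; left.
by rewrite cj ck.
Qed.

(** Rudin-Keisler equivalence, between ultrafilters on possibly different
    types. *)
Definition RK_equiv (S T : Type) (u : Uf S) (v : Uf T) : Prop :=
  exists2 f : S -> T, ae_inj u f & push f u = v.

Lemma RK_equiv_refl (T : Type) (u : Uf T) : RK_equiv u u.
Proof. by exists id; [exists setT => //; exact: filterT|exact: push_id]. Qed.

Lemma ae_inj_comp (R S T : Type) (u : Uf R) (f : R -> S) (g : S -> T) :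
  ae_inj u f -> ae_inj (push f u) g -> ae_inj u (g \o f).
Proof.
move=> [X uX fX] [Y uY gY]; exists (X `&` f @^-1` Y); first exact: filterI.
by move=> x y [Xx Yx] [Xy Yy] /gY fxy; exact/fX/fxy.
Qed.

Lemma RK_equiv_trans (R S T : Type) (u : Uf R) (v : Uf S) (w : Uf T) :
  RK_equiv u v -> RK_equiv v w -> RK_equiv u w.
Proof.
move=> [f fi <-] [g gi <-]; exists (g \o f); last by rewrite push_comp.
exact: ae_inj_comp.
Qed.

(** An inverse of [f] on the image of the large set where [f] is injective,
    extended arbitrarily. *)
Lemma RK_equiv_sym (S T : Type) (u : Uf S) (v : Uf T) : RK_equiv u v -> RK_equiv v u.
Proof.
move=> [f [X uX fX] <-].
have [x0 _] := Uf_ex uX.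
have /choice [g gP] : forall y, exists x, forall x', X x' /\ f x' = y -> x' = x.
  move=> y; apply: bound_subsingleton => // x x' [Xx <-] [Xx' /esym].
  exact: fX.
have gf x : X x -> g (f x) = x by move=> Xx; rewrite -(gP (f x) x).
exists g.
  exists (f @` X); first by rewrite pushE; apply: filterS uX => x Xx; exists x.
  by move=> _ _ [x Xx <-] [x' Xx' <-]; rewrite !gf // => ->.
rewrite push_comp -[RHS]push_id; apply: push_ae.
by apply: filterS uX => x Xx /=; rewrite gf.
Qed.

(** * Nonprincipal ultrafilters over almost bounded structures *)

Section AlmostBounded.
Context {M : structure} {n : nat}.
Hypothesis exceptional_finite : finite_set (@infinite_degree M).
Hypothesis degree_le : forall x : M, ~ infinite_degree x ->
  successors x #<= `I_n /\ predecessors x #<= `I_n.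

Let regular : set M := ~` @infinite_degree M.

(** Distinct regular points with a common regular predecessor, or a common
    regular successor, get different colours. So a regular point has at most one
    regular successor, and at most one regular predecessor, of each colour:
    fixing colours turns the edge relation into partial injections. *)
Lemma local_coloring : exists d (c : M -> 'I_d),
  (forall x y y', regular x -> regular y -> regular y' ->
     edge x y -> edge x y' -> c y = c y' -> y = y') /\
  (forall x x' y, regular x -> regular x' -> regular y ->
     edge x y -> edge x' y -> c x = c x' -> x = x').
Proof.
have /choice [s sP] : forall x : M, exists s : 'I_n -> M,
    regular x -> forall y, edge x y -> exists i, y = s i.
  move=> x; have [rx|nrx] := pselect (regular x); last by exists (fun=> x).
  by have [/(card_le_enum x) [s sP] _] := degree_le rx; exists s.
have /choice [p pP] : forall x : M, exists s : 'I_n -> M,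
    regular x -> forall y, edge y x -> exists i, y = s i.
  move=> x; have [rx|nrx] := pselect (regular x); last by exists (fun=> x).
  by have [_ /(card_le_enum x) [s' s'P]] := degree_le rx; exists s'.
pose E y y' := [/\ regular y, regular y', y <> y' &
  (exists2 x, regular x & edge x y /\ edge x y') \/
  (exists2 x, regular x & edge y x /\ edge y' x)].
pose N y (k : bool * ('I_n * 'I_n)) :=
  if k.1 then s (p y k.2.1) k.2.2 else p (s y k.2.1) k.2.2.
have [|||c cP] := @bounded_coloring M _ E N.
- by move=> x y [rx ry xy [[z rz [zx zy]]|[z rz [zx zy]]]]; split=> //;
    [exact: nesym|left; exists z|exact: nesym|right; exists z].
- by move=> x [].
- move=> y y' [ry ry' _ [[z rz [zy zy']]|[z rz [yz y'z]]]].
    have [i zi] := pP y ry z zy; have [j yj] := sP z rz y' zy'.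
    by exists (true, (i, j)); rewrite /N /= -zi.
  have [i zi] := sP y ry z yz; have [j yj] := pP z rz y' y'z.
  by exists (false, (i, j)); rewrite /N /= -zi.
exists _, c; split=> [x y y' rx ry ry' xy xy'|x x' y rx rx' ry xy x'y] cc;
  apply: contrapT => ne.
  by have /cP : E y y' by split=> //; left; exists x.
by have /cP : E x x' by split=> //; right; exists y.
Qed.

Lemma nonprincipal_regular (u : Uf M) : ~ principal u -> sval u regular.
Proof.
move=> np; apply: Uf_setC => /(Uf_finite_principal exceptional_finite) [x _ ux].
by apply: np; rewrite ux; exact: principal_point.
Qed.

(** The function sends a point in the large colour class of [u] to its unique
    successor in the large colour class of [v]. *)
Lemma ue_edge_function (u v : Uf M) : sval u regular -> sval v regular ->
  ue_edge u v -> exists f : M -> M,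
    [/\ ae_inj u f, push f u = v & sval u [set x | edge x (f x)]].
Proof.
move=> ur vr uv; have [d [c [cs cp]]] := local_coloring.
have [k uk] := Uf_fiber u c; have [l vl] := Uf_fiber v c.
pose Y := regular `&` [set x | c x = l].
have vY : sval v Y by apply: filterI.
have [x0 _] := Uf_ex ur.
have /choice [f fP] : forall x, exists y, dia Y x -> Y y /\ edge x y.
  move=> x; have [[y xy Yy]|nY] := pselect (dia Y x); first by exists y.
  by exists x0.
have uX : sval u (regular `&` [set x | c x = k] `&` dia Y).
  by do 2?apply: filterI => //; exact: uv.
exists f; split.
- exists (regular `&` [set x | c x = k] `&` dia Y) => //.
  move=> x x' [[rx cx] /fP [[ry cy] xy]] [[rx' cx'] /fP [[ry' cy'] xy']] fxx'.
  by apply: (cp x x' (f x)) => //; [rewrite fxx'|rewrite cx cx'].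
- symmetry; apply: Uf_sub_eq => Z vZ; rewrite pushE.
  have uZ : sval u (dia (Z `&` Y)) by apply: uv; apply: filterI.
  apply: filterS (filterI uX uZ) => x [[[rx _] /fP [[ry cy] xy]] [z xz [Zz [rz cz]]]].
  by rewrite /= (cs x (f x) z) // cz.
- by apply: filterS uX => x [_ /fP []].
Qed.

Lemma ue_edge_RK_equiv (u v : Uf M) : sval u regular -> sval v regular ->
  ue_edge u v -> RK_equiv u v.
Proof. by move=> ur vr /(ue_edge_function ur vr) [f [fi fv _]]; exists f. Qed.

(** Edges between ultrafilters of one Rudin-Keisler class are witnessed almost
    everywhere, for any choice of injective representatives: [g] has the same
    image ultrafilter as the composite of [f] with the function carrying the
    edge, hence agrees with it almost everywhere. *)
Lemma push_edge_ae (J : Type) (W : Uf J) (f g : J -> M) :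
  ae_inj W f -> ae_inj W g ->
  sval (push f W) regular -> sval (push g W) regular ->
  ue_edge (push f W) (push g W) -> sval W [set j | edge (f j) (g j)].
Proof.
move=> fi gi fr gr /(ue_edge_function fr gr) [h [hi hfg fh]].
have hf : sval W [set j | (h \o f) j = g j].
  by apply: push_inj_ae => //; [exact: ae_inj_comp|rewrite -push_comp].
by apply: filterS (filterI hf fh) => j /= [<-].
Qed.

(** Principal ultrafilters go to their points, and each Rudin-Keisler class of
    nonprincipal ones is evaluated at one index: the given index [j] for the
    class of [W], to which all nonprincipal pins belong, and a generic point of
    a representative ultrafilter for each other class. An edge between
    nonprincipal ultrafilters never leaves a class. The large sets [U u] are a
    parameter, in order that further properties of [h u] can be prescribed. *)
Lemma approximation (J : Type) (W : Uf J) k (x : 'I_k -> J -> M) (m0 : M)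
    (F : set (Uf M)) (U : Uf M -> set M) :
  (forall i, ~ principal (push (x i) W) -> ae_inj W (x i)) ->
  finite_set F -> (forall u, sval u (U u)) ->
  sval W [set j | exists h : Uf M -> M,
    [/\ forall y, h (point_Uf y) = y,
        forall i, h (push (x i) W) = x i j,
        forall u, F u -> ~ principal u -> U u (h u) &
        forall u v, F u -> F v -> ~ principal u -> ~ principal v ->
          ue_edge u v -> edge (h u) (h v)]].
Proof.
move=> xi Ffin UP.
have sections (I : Type) (V : Uf I) : exists f : Uf M -> I -> M, forall u,
    RK_equiv V u -> ae_inj V (f u) /\ push (f u) V = u.
  have H u : exists f : I -> M, RK_equiv V u -> ae_inj V f /\ push f V = u.
    have [[f fi fu]|nVu] := pselect (RK_equiv V u); first by exists f.
    by exists (fun=> m0).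
  by have [f fP] := choice H; exists f.
(* Indices at which the representatives of one class behave as required. *)
pose good (I : Type) (V : Uf I) (f : Uf M -> I -> M) : set I := [set j |
  (forall u, F u -> ~ principal u /\ RK_equiv V u -> U u (f u j)) /\
  (forall u, F u -> forall v, F v -> [/\ ~ principal u, ~ principal v, RK_equiv V u,
      RK_equiv V v & ue_edge u v] -> edge (f u j) (f v j))].
have goodP (I : Type) (V : Uf I) (f : Uf M -> I -> M) :
    (forall u, RK_equiv V u -> ae_inj V (f u) /\ push (f u) V = u) ->
    sval V (good I V f).
  move=> fP; apply: filterI.
    apply: filter_finite_forall => // u Fu.
    have [[np Vu]|nH] := pselect (~ principal u /\ RK_equiv V u); last first.
      by apply: filterS filterT => j _ /nH.
    have [_ fu] := fP u Vu.
    have : sval (push (f u) V) (U u) by rewrite fu.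
    by rewrite pushE; apply: filterS => j Uj _.
  apply: filter_finite_forall => // u Fu; apply: filter_finite_forall => // v Fv.
  have [[npu npv Vu Vv uv]|nH] := pselect [/\ ~ principal u, ~ principal v, RK_equiv V u,
      RK_equiv V v & ue_edge u v]; last by apply: filterS filterT => j _ /nH.
  have [fiu fu] := fP u Vu; have [fiv fv] := fP v Vv.
  have : sval V [set j | edge (f u j) (f v j)].
    by apply: push_edge_ae => //; rewrite ?fu ?fv //; exact: nonprincipal_regular.
  by apply: filterS => j ej _.
have [fW fWP] := sections _ W.
have /choice [fr frP] : forall r : Uf M, exists f : Uf M -> M -> M, forall u,
    RK_equiv r u -> ae_inj r (f u) /\ push (f u) r = u by move=> r; exact: sections.
have /choice [S SP] : forall r : Uf M, exists z, good M r (fr r) z.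
  by move=> r; exact: (Uf_ex (goodP _ r (fr r) (frP r))).
have /choice [pt ptP] : forall u : Uf M, exists y, principal u -> u = point_Uf y.
  move=> u; have [/principalP [y ->]|np] := pselect (principal u); first by exists y.
  by exists m0.
have /choice [rep repP] : forall P : set (Uf M), exists r, (exists u, P u) -> P r.
  move=> P; have [[u Pu]|nP] := pselect (exists u, P u); first by exists u.
  by exists (point_Uf m0).
(* A function of the whole class, so that equivalent ultrafilters share it. *)
pose rho (u : Uf M) := rep [set r | RK_equiv r u].
have rhoP u : RK_equiv (rho u) u.
  by apply: (repP [set r | RK_equiv r u]); exists u; exact: RK_equiv_refl.
have rhoE u v : RK_equiv u v -> rho u = rho v.
  move=> uv; rewrite /rho; congr (rep _); apply/seteqP; split=> r /= ru.
    exact: RK_equiv_trans uv.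
  exact: RK_equiv_trans (RK_equiv_sym uv).
have Wx : sval W [set j | forall i, ~ principal (push (x i) W) ->
    fW (push (x i) W) j = x i j].
  apply: filter_forall => i.
  have [pi|npi] := pselect (principal (push (x i) W)).
    by apply: filterS filterT => j _ /(_ pi).
  have [fi fp] := fWP (push (x i) W) (ex_intro2 _ _ (x i) (xi i npi) erefl).
  by apply: filterS (push_inj_ae fi (xi i npi) fp) => j fj _.
have Wp : sval W [set j | forall i, principal (push (x i) W) ->
    pt (push (x i) W) = x i j].
  apply: filter_forall => i.
  have [pi|npi] := pselect (principal (push (x i) W)); last first.
    by apply: filterS filterT => j _ /npi.
  have : sval (push (x i) W) [set pt (push (x i) W)].
    by rewrite {1}(ptP _ pi); apply/point_UfE.
  by rewrite pushE; apply: filterS => j ->.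
apply: filterS (filterI (goodP _ W fW fWP) (filterI Wx Wp)) => j [[gU ge] [xj pj]].
exists (fun u => if `[< principal u >] then pt u else
  if `[< RK_equiv W u >] then fW u j else fr (rho u) u (S (rho u))); split.
- move=> y; have py := principal_point y.
  by rewrite asboolT //; apply: point_Uf_inj; rewrite -ptP.
- move=> i; case: asboolP => [pi|npi]; first exact: pj.
  by rewrite asboolT ?xj //; exists (x i) => //; exact: xi.
- move=> u Fu npu; rewrite asboolF //; case: asboolP => Wu; first exact: gU.
  by have [H _] := SP (rho u); apply: H.
- move=> u v Fu Fv npu npv uv; rewrite (asboolF npu) (asboolF npv).
  have ruv := ue_edge_RK_equiv (nonprincipal_regular npu) (nonprincipal_regular npv) uv.
  case: asboolP => Wu.
    have Wv : RK_equiv W v := RK_equiv_trans Wu ruv.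
    by rewrite asboolT //; apply: ge.
  have nWv : ~ RK_equiv W v by move=> Wv; apply: Wu; exact: RK_equiv_trans (RK_equiv_sym ruv).
  rewrite asboolF // (rhoE u v ruv).
  have [_ H] := SP (rho v); apply: H => //; split=> //.
  by rewrite -(rhoE u v ruv).
Qed.

End AlmostBounded.

(** * Classes of structures definable by a first-order formula *)

Section Environments.
Context {T : Type}.

Lemma extend_env0 n (a : T) (e : 'I_n -> T) : extend_env a e ord0 = a.
Proof. by rewrite /extend_env unlift_none. Qed.

Lemma extend_envS n (a : T) (e : 'I_n -> T) i : extend_env a e (lift ord0 i) = e i.
Proof. by rewrite /extend_env liftK. Qed.

Lemma extend_env_eta n (e : 'I_n.+1 -> T) :
  extend_env (e ord0) (fun i => e (lift ord0 i)) = e.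
Proof.
apply/funext => i; case: (unliftP ord0 i) => [j ->|->].
  by rewrite extend_envS.
by rewrite extend_env0.
Qed.

Definition cat_env m n (y : 'I_m -> T) (x : 'I_n -> T) (i : 'I_(m + n)) : T :=
  match fintype.split i with inl j => y j | inr j => x j end.

Lemma cat_envl m n (y : 'I_m -> T) (x : 'I_n -> T) i : cat_env y x (lshift n i) = y i.
Proof. by rewrite /cat_env (unsplitK (inl i : 'I_m + 'I_n)). Qed.

Lemma cat_envr m n (y : 'I_m -> T) (x : 'I_n -> T) i : cat_env y x (rshift m i) = x i.
Proof. by rewrite /cat_env (unsplitK (inr i : 'I_m + 'I_n)). Qed.

Lemma cat_env_extend m n (a : T) (y : 'I_m -> T) (x : 'I_n -> T) :
  cat_env (extend_env a y) x = extend_env a (cat_env y x) :> ('I_(m + n).+1 -> T).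
Proof.
apply/funext => i; case: (unliftP ord0 i) => [j ->|->]; last first.
  have -> : ord0 = lshift n (@ord0 m) :> 'I_(m.+1 + n) by exact: val_inj.
  rewrite cat_envl extend_env0 (_ : lshift n (@ord0 m) = ord0 :> 'I_(m + n).+1).
    by rewrite extend_env0.
  exact: val_inj.
rewrite extend_envS; case: (split_ordP j) => i' ->.
  have -> : lift ord0 (lshift n i') = lshift n (lift ord0 i') :> 'I_(m.+1 + n).
    exact: val_inj.
  by rewrite !cat_envl extend_envS.
have -> : lift ord0 (rshift m i') = rshift m.+1 i' :> 'I_(m.+1 + n).
  exact: val_inj.
by rewrite !cat_envr.
Qed.

End Environments.

(** Definability by one formula uniformly in the structure, which replaces the
    manipulation of formulas by closure properties. *)
Definition definable n (P : forall M : structure, ('I_n -> M) -> Prop) : Prop :=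
  exists f : fo_formula n, forall M e, fo_sat f e <-> P M e.

Lemma definable_ext n (P Q : forall M : structure, ('I_n -> M) -> Prop) :
  (forall M e, P M e <-> Q M e) -> definable P -> definable Q.
Proof. by move=> PQ [f fP]; exists f => M e; split=> [/fP/PQ|/PQ/fP]. Qed.

Lemma definable_eq n (i j : 'I_n) : definable (fun M e => e i = e j).
Proof. by exists (FEq i j). Qed.

Lemma definable_edge n (i j : 'I_n) : definable (fun M e => edge (e i) (e j)).
Proof. by exists (FEdge i j). Qed.

Lemma definable_not n (P : forall M : structure, ('I_n -> M) -> Prop) :
  definable P -> definable (fun M e => ~ P M e).
Proof. by move=> [f fP]; exists (FNeg f) => M e /=; split=> H /fP. Qed.

Lemma definable_and n (P Q : forall M : structure, ('I_n -> M) -> Prop) :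
  definable P -> definable Q -> definable (fun M e => P M e /\ Q M e).
Proof.
by move=> [f fP] [g gQ]; exists (FAnd f g) => M e /=; split=> -[/fP ? /gQ].
Qed.

Lemma definable_imp n (P Q : forall M : structure, ('I_n -> M) -> Prop) :
  definable P -> definable Q -> definable (fun M e => P M e -> Q M e).
Proof.
move=> dP dQ; apply: definable_ext (definable_not (definable_and dP (definable_not dQ))).
move=> M e; split=> [H p|H [p nq]]; last exact/nq/H.
by apply: contrapT => nq; apply: H.
Qed.

Lemma definable_const n (C : Prop) : definable (fun M (e : 'I_n -> M) => C).
Proof.
have [f] : exists f : fo_formula n, True by exists (FEx (FEq ord0 ord0)).
have [c|nc] := pselect C.
  exists (FNeg (FAnd f (FNeg f))) => M e /=; split=> // _ [fe]; exact.
by exists (FAnd f (FNeg f)) => M e /=; split=> // -[].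
Qed.

Lemma definable_ex n (P : forall M : structure, ('I_n.+1 -> M) -> Prop) :
  definable P -> definable (fun M e => exists a, P M (extend_env a e)).
Proof. by move=> [f fP]; exists (FEx f) => M e /=; split=> -[a /fP]; exists a. Qed.

Lemma definable_all n (P : forall M : structure, ('I_n.+1 -> M) -> Prop) :
  definable P -> definable (fun M e => forall a, P M (extend_env a e)).
Proof.
move=> dP; apply: definable_ext (definable_not (definable_ex (definable_not dP))).
move=> M e; split=> [H a|H [a]]; last by case.
by apply: contrapT => nP; apply: H; exists a.
Qed.

Lemma definable_all_fin n (I : finType)
    (P : I -> forall M : structure, ('I_n -> M) -> Prop) :
  (forall i, definable (P i)) -> definable (fun M e => forall i, P i M e).
Proof.
move=> dP; have H (s : seq I) : definable (fun M e => forall i, i \in s -> P i M e).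
  elim: s => [|i s IH]; first exact: definable_ext (definable_const n True).
  apply: definable_ext (definable_and (dP i) IH) => M e; split=> [[Pi Ps] j|Ps].
    by rewrite inE => /predU1P [->|/Ps].
  by split=> [|j js]; apply: Ps; rewrite inE ?eqxx ?js ?orbT.
by apply: definable_ext (H (enum I)) => M e; split=> Ps i //; apply: Ps; rewrite mem_enum.
Qed.

Lemma definable_ex_fin n (I : finType)
    (P : I -> forall M : structure, ('I_n -> M) -> Prop) :
  (forall i, definable (P i)) -> definable (fun M e => exists i, P i M e).
Proof.
move=> dP.
have := definable_not (definable_all_fin (fun i => definable_not (dP i))).
apply: definable_ext => M e; split=> [H|[i Pi] /(_ i)]; last by case.
by apply: contrapT => nP; apply: H => i Pi; apply: nP; exists i.
Qed.

Lemma definable_ex_block m n (P : forall M : structure, ('I_(m + n) -> M) -> Prop) :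
  definable P -> definable (fun M x => exists y : 'I_m -> M, P M (cat_env y x)).
Proof.
elim: m P => [|m IH] P dP.
  have cat0 M (y : 'I_0 -> M) (x : 'I_n -> M) : cat_env y x = x.
    by apply/funext => i; rewrite -[in RHS](cat_envr y x i); congr cat_env; apply: val_inj.
  apply: definable_ext dP => M x; split=> [Px|[y]]; last by rewrite cat0.
  by exists (@empty_env M); rewrite cat0.
apply: definable_ext (IH _ (definable_ex dP)) => M x; split=> [[y [a Pa]]|[y Py]].
  by exists (extend_env a y); rewrite cat_env_extend.
exists (fun i => y (lift ord0 i)), (y ord0).
by rewrite -cat_env_extend extend_env_eta.
Qed.

Lemma definable_all_block m n (P : forall M : structure, ('I_(m + n) -> M) -> Prop) :
  definable P -> definable (fun M x => forall y : 'I_m -> M, P M (cat_env y x)).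
Proof.
move=> dP; have := definable_not (definable_ex_block (definable_not dP)).
apply: definable_ext => M e; split=> [H y|H [y]]; last by case.
by apply: contrapT => nP; apply: H; exists y.
Qed.

(** Closing the tuple existentially one variable at a time; in the empty
    structure this still agrees with quantifying over tuples. *)
Lemma definable_sentence n (P : forall M : structure, ('I_n -> M) -> Prop) :
  definable P -> exists s : fo_sentence, forall M, fo_true M s <-> exists e, P M e.
Proof.
elim: n P => [|n IH] P.
  move=> [f fP]; exists f => M; split=> [/fP Pe|[e Pe]]; first by exists (@empty_env M).
  by apply/fP; congr (P M _): Pe; apply/funext => -[].
move=> /definable_ex /IH [s sP]; exists s => M; split=> [/sP [e [a Pe]]|[e Pe]].
  by exists (extend_env a e).
by apply/sP; exists (fun i => e (lift ord0 i)), (e ord0); rewrite extend_env_eta.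
Qed.

Lemma elementarily_equivalent_definable (A B : structure) n
    (P : forall M : structure, ('I_n -> M) -> Prop) :
  elementarily_equivalent A B -> definable P ->
  (exists e, P A e) -> exists e, P B e.
Proof. by move=> AB /definable_sentence [s sP] /sP /AB /sP. Qed.

(** * Finite approximations of a labelling *)

(** Out-degree at least [n], phrased with a tuple so that it is visibly
    first-order. *)
Definition wide (M : structure) (n : nat) (a : M) : Prop :=
  exists y : 'I_n -> M, (forall i, edge a (y i)) /\ (forall i j, i <> j -> y i <> y j).

Lemma wide_infinite (M : structure) (a : M) N : infinite_set (successors a) -> wide N a.
Proof.
move=> ainf; elim: N => [|m [y [ay yy]]]; first by exists (fun=> a); split=> -[].
have [b [ab nb]] : successors a `\` (y @` setT) !=set0.
  apply: infinite_setN0; apply: infinite_setD => //.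
  exact/finite_image/finite_finset.
exists (extend_env b y); split=> [i|i j].
  by case: (unliftP ord0 i) => [i' ->|->]; rewrite ?extend_env0 ?extend_envS.
case: (unliftP ord0 i) => [i' ->|->]; case: (unliftP ord0 j) => [j' ->|->] //;
  rewrite ?extend_env0 ?extend_envS => ij.
- by apply: yy => ij'; apply: ij; rewrite ij'.
- by move=> yb; apply: nb; exists i'.
- by move=> yb; apply: nb; exists j'.
Qed.

Lemma wide_infinite_degree (M : structure) n (a : M) :
  (~ infinite_degree a -> successors a #<= `I_n) -> wide n.+1 a -> infinite_degree a.
Proof.
move=> deg [y [ay yy]]; apply: contrapT => /deg /(card_le_enum a) [s sP].
have /choice [r rP] : forall i, exists j, y i = s j by move=> i; exact: sP (ay i).
have r_inj : injective r.
  by move=> i j rij; apply: contrapT => /yy; apply; rewrite !rP rij.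
by have := leq_card r r_inj; rewrite !card_ord ltnn.
Qed.

Section Labelling.
Context {L K : finType} (head body : L -> K -> bool).

(** A label [s] records truth values: [body s k] is that of a formula [k], and
    [head s k] that of its diamond. Coherence says that [head] agrees with the
    Kripke semantics; here it is restricted to a finite tuple. The first condition makes the
    labelling one of points rather than of positions. In the last one, a
    witness is required only when all successors are listed, since otherwise it
    may lie outside the tuple. *)
Definition coherent_on (M : structure) n (e : 'I_n -> M) (l : 'I_n -> L) : Prop :=
  [/\ forall i j, e i = e j -> l i = l j,
      forall i j k, edge (e i) (e j) -> body (l j) k -> head (l i) k &
      forall i k, head (l i) k -> (forall z, edge (e i) z -> exists j, z = e j) ->
        exists j, edge (e i) (e j) /\ body (l j) k].

Lemma definable_coherent_on n (l : 'I_n -> L) :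
  definable (fun M (e : 'I_n -> M) => coherent_on e l).
Proof.
have H1 : definable (fun M (e : 'I_n -> M) => forall i j, e i = e j -> l i = l j).
  do 2 apply: definable_all_fin => ?.
  by apply: definable_imp; [exact: definable_eq|exact: definable_const].
have H2 : definable (fun M (e : 'I_n -> M) => forall i j k,
    edge (e i) (e j) -> body (l j) k -> head (l i) k).
  do 3 apply: definable_all_fin => ?.
  by apply: definable_imp; [exact: definable_edge|exact: definable_const].
have H3 : definable (fun M (e : 'I_n -> M) => forall i k, head (l i) k ->
    (forall z, edge (e i) z -> exists j, z = e j) ->
    exists j, edge (e i) (e j) /\ body (l j) k).
  apply: definable_all_fin => i; apply: definable_all_fin => k.
  apply: definable_imp; first exact: definable_const.
  apply: definable_imp; last first.
    apply: definable_ex_fin => j.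
    by apply: definable_and; [exact: definable_edge|exact: definable_const].
  apply: (@definable_ext _ (fun M (e : 'I_n -> M) => forall z,
    edge (extend_env z e (lift ord0 i)) (extend_env z e ord0) ->
    exists j, extend_env z e ord0 = extend_env z e (lift ord0 j))).
    move=> M e; split=> H z; have := H z; rewrite extend_env0 extend_envS => Hz /Hz.
      by case=> j ->; exists j; rewrite extend_envS.
    by case=> j zj; exists j; rewrite extend_envS.
  apply: (@definable_all _ (fun M e => edge (e (lift ord0 i)) (e ord0) ->
    exists j : 'I_n, e ord0 = e (lift ord0 j))).
  apply: definable_imp; first exact: definable_edge.
  by apply: definable_ex_fin => j; exact: definable_eq.
apply: definable_ext (definable_and H1 (definable_and H2 H3)) => M e.
by split=> [[? [? ?]]|[? ? ?]].
Qed.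

(** The first-order trace of a labelled tuple of pins. The points of large
    out-degree are among the entries marked by [hub], the edges in [C] supply
    the witnesses that these points need, and the labels [t] of the pins
    are compatible with labelling any [m] further points. *)
Definition extendible k (hub : pred 'I_k) (C : rel 'I_k) (t : 'I_k -> L) n m
    (M : structure) (x : 'I_k -> M) : Prop :=
  [/\ forall a : M, wide n a -> exists2 i, hub i & a = x i,
      forall i j, C i j -> edge (x i) (x j) &
      forall y : 'I_m -> M, exists l : {ffun 'I_(m + k) -> L},
        (forall i, l (rshift m i) = t i) /\ coherent_on (cat_env y x) l].

Lemma definable_extendible k (hub : pred 'I_k) (C : rel 'I_k) (t : 'I_k -> L) n m :
  definable (@extendible k hub C t n m).
Proof.
have H1 : definable (fun M (x : 'I_k -> M) =>
    forall a : M, wide n a -> exists2 i, hub i & a = x i).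
  (* The first quantified variable is the wide point, the others its successors. *)
  pose Q (M : structure) (e : 'I_(n.+1 + k) -> M) :=
    (forall i, edge (e (lshift k ord0)) (e (lshift k (lift ord0 i)))) ->
    (forall i j, i <> j ->
       e (lshift k (lift ord0 i)) <> e (lshift k (lift ord0 j))) ->
    exists i, hub i /\ e (lshift k ord0) = e (rshift n.+1 i).
  have dQ : definable Q.
    apply: definable_imp; first by apply: definable_all_fin => i; exact: definable_edge.
    apply: definable_imp.
      do 2 apply: definable_all_fin => ?.
      by apply: definable_imp; [exact: definable_const|exact/definable_not/definable_eq].
    apply: definable_ex_fin => i.
    by apply: definable_and; [exact: definable_const|exact: definable_eq].
  apply: definable_ext (definable_all_block dQ) => M x; split=> [H a [y [ay yy]]|H y].
    have := H (extend_env a y); rewrite /Q; case.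
    - by move=> i; rewrite !cat_envl extend_env0 extend_envS.
    - by move=> i j ij; rewrite !cat_envl !extend_envS; exact: yy.
    - by move=> i [hi]; rewrite cat_envl cat_envr extend_env0; exists i.
  rewrite /Q => ye yn.
  have [|i hi yi] := H (y ord0).
    exists (fun i => y (lift ord0 i)); split=> [i|i j ij].
      by have := ye i; rewrite !cat_envl.
    by have := yn i j ij; rewrite !cat_envl.
  by exists i; rewrite cat_envl cat_envr.
have H2 : definable (fun M (x : 'I_k -> M) => forall i j, C i j -> edge (x i) (x j)).
  do 2 apply: definable_all_fin => ?.
  by apply: definable_imp; [exact: definable_const|exact: definable_edge].
have H3 : definable (fun M (x : 'I_k -> M) =>
    forall y : 'I_m -> M, exists l : {ffun 'I_(m + k) -> L},
      (forall i, l (rshift m i) = t i) /\ coherent_on (cat_env y x) l).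
  apply: (@definable_all_block m k (fun M e => exists l : {ffun 'I_(m + k) -> L},
      (forall i, l (rshift m i) = t i) /\ coherent_on e l)).
  apply: definable_ex_fin => l.
  by apply: definable_and; [exact: definable_const|exact: definable_coherent_on].
apply: definable_ext (definable_and H1 (definable_and H2 H3)) => M e.
by split=> [[? [? ?]]|[? ? ?]].
Qed.

End Labelling.

(** * From the ultrafilter extension to the structure *)

Section Realization.
Context {L K : finType} (head body : L -> K -> bool).

Definition coherent (M : structure) (l : Uf M -> L) : Prop :=
  forall u k, head (l u) k <-> exists2 v, ue_edge u v & body (l v) k.

(** The functions [e ^~ i] stand for elements of an ultrapower of [M], which are
    sent to ultrafilters over [M] by pushing [W] forward. The last condition of
    coherence holds because, if all successors of [e j i] are listed in [e j],
    each successor [v] of [push (e ^~ i) W] is one of the listed ultrafilters: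
    otherwise sets separating [v] from all of them would give a contradiction. *)
Lemma coherent_on_push (M : structure) (l : Uf M -> L) (J : Type) (W : Uf J)
    n (e : J -> 'I_n -> M) :
  coherent l ->
  sval W [set j | coherent_on head body (e j) (fun i => l (push (e ^~ i) W))].
Proof.
move=> lP; set t := fun i => l (push (e ^~ i) W).
have C1 : sval W [set j | forall i i', e j i = e j i' -> t i = t i'].
  apply: filter_forall => i; apply: filter_forall => i'.
  have [ti|nt] := pselect (t i = t i'); first by apply: filterS filterT.
  have : ~ sval W [set j | e j i = e j i'].
    by move=> We; apply: nt; rewrite /t (push_ae We).
  by move=> /Uf_setC; apply: filterS => j ne /ne.
have C2 : sval W [set j | forall i i' k,
    edge (e j i) (e j i') -> body (t i') k -> head (t i) k].
  apply: filter_forall => i; apply: filter_forall => i'.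
  have [We|/Uf_setC] := pselect (sval W [set j | edge (e j i) (e j i')]); last first.
    by apply: filterS => j ne k /ne.
  apply: filterS filterT => j _ k _ bk; apply/lP; exists (push (e ^~ i') W) => //.
  exact: ue_edge_push.
have C3 : sval W [set j | forall i k, head (t i) k ->
    (forall z, edge (e j i) z -> exists i', z = e j i') ->
    exists i', edge (e j i) (e j i') /\ body (t i') k].
  apply: filter_forall => i; apply: filter_forall => k.
  have [|nh] := pselect (head (t i) k); last by apply: filterS filterT => j _ /nh.
  move=> /lP [v iv bk].
  have /choice [Z ZP] : forall i', exists Z : set M, sval v Z /\
      (push (e ^~ i') W <> v -> sval W [set j | ~ Z (e j i')]).
    move=> i'; have [->|/nesym /Uf_sep [Z [vZ wZ]]] := pselect (push (e ^~ i') W = v).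
      by exists setT; split=> //; exact: filterT.
    by exists Z.
  have vZ : sval v [set y | forall i', Z i' y].
    by apply: filter_forall => i'; case: (ZP i').
  have WZ : sval W [set j | forall i', push (e ^~ i') W <> v -> ~ Z i' (e j i')].
    apply: filter_forall => i'; have [ev|nev] := pselect (push (e ^~ i') W = v).
      by apply: filterS filterT => j _ /(_ ev).
    by have [_ /(_ nev)] := ZP i'; apply: filterS.
  have := iv _ vZ; rewrite pushE => Wd.
  apply: filterS (filterI WZ Wd) => j [jZ [y ey yZ]] _ /(_ y ey) [i' yi'].
  exists i'; rewrite -yi'; split=> //.
  have -> : t i' = l v; last by [].
  rewrite /t; congr l; apply: contrapT => /jZ; rewrite -yi'; exact.
by apply: filterS (filterI C1 (filterI C2 C3)) => j [? [? ?]]; split.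
Qed.

(** Boxes of large sets generate a proper filter on the product. *)
Lemma joint_ultrafilter (T : Type) k (p : 'I_k -> Uf T) :
  exists W : Uf ('I_k -> T), forall i, push (fun x => x i) W = p i.
Proof.
pose F : set_system ('I_k -> T) := [set S | exists2 U : 'I_k -> set T,
  (forall i, sval (p i) (U i)) & forall x, (forall i, U i (x i)) -> S x].
have FF : Filter F.
  split.
  - by exists (fun=> setT) => // i; exact: filterT.
  - move=> S S' [U pU US] [U' pU' US']; exists (fun i => U i `&` U' i).
      by move=> i; apply: filterI.
    by move=> x Ux; split; [apply: US|apply: US'] => i; case: (Ux i).
  - by move=> S S' SS' [U pU US]; exists U => // x Ux; apply/SS'/US.
have [|W FW] := @Uf_extend _ F FF.
  move=> S [U pU US].
  have /choice [x xU] : forall i, exists y, U i y by move=> i; exact: Uf_ex (pU i).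
  by exists x; exact: US.
exists W => i; symmetry; apply: Uf_sub_eq => X piX; rewrite pushE; apply: FW.
exists (fun j => if j == i then X else setT).
  by move=> j; case: eqP => [->|_] //; exact: filterT.
by move=> x /(_ i); rewrite eqxx.
Qed.

Definition hub_of (M : structure) n k (p : 'I_k -> Uf M) (i : 'I_k) : bool :=
  `[< exists2 a, wide n a & p i = point_Uf a >].

(** Restricted to edges leaving principal ultrafilters, as only these edges
    hold at almost every tuple for every ultrafilter projecting to [p]. *)
Definition hub_edge (M : structure) n k (p : 'I_k -> Uf M) (i j : 'I_k) : bool :=
  hub_of n p i && `[< ue_edge (p i) (p j) >].

(** Almost every tuple, for an ultrafilter projecting to the pins, has the
    required properties. *)
Lemma extendible_ex (M : structure) (l : Uf M -> L) n k (p : 'I_k -> Uf M) m :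
  coherent l ->
  (forall a : M, wide n a -> exists i, p i = point_Uf a) ->
  exists x : 'I_k -> M,
    extendible head body (hub_of n p) (hub_edge n p) (fun i => l (p i)) n m x.
Proof.
move=> lP wp; have [W Wp] := joint_ultrafilter p.
have E1 : sval W [set x | forall i a, p i = point_Uf a -> x i = a].
  apply: filter_forall => i.
  have [[b pb]|np] := pselect (exists b, p i = point_Uf b); last first.
    by apply: filterS filterT => x _ a pa; case: np; exists a.
  have : sval (push (fun x => x i) W) [set b] by rewrite Wp pb; apply/point_UfE.
  by rewrite pushE; apply: filterS => x /= xb a; rewrite pb => /(@point_Uf_inj M) <-.
have E2 : sval W [set x | forall i j a, p i = point_Uf a -> ue_edge (p i) (p j) ->
    edge a (x j)].
  apply: filter_forall => i; apply: filter_forall => j.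
  have [[b pb]|np] := pselect (exists b, p i = point_Uf b); last first.
    by apply: filterS filterT => x _ a pa; case: np; exists a.
  have [ij|nij] := pselect (ue_edge (p i) (p j)); last first.
    by apply: filterS filterT => x _ a _ /nij.
  have : sval (push (fun x => x j) W) (successors b).
    by rewrite Wp; apply/ue_edge_pointl; rewrite -pb.
  by rewrite pushE; apply: filterS => x /= bx a; rewrite pb => /(@point_Uf_inj M) <-.
pose good (x : 'I_k -> M) (y : 'I_m -> M) := exists l' : {ffun 'I_(m + k) -> L},
  (forall i, l' (rshift m i) = l (p i)) /\ coherent_on head body (cat_env y x) l'.
have E3 : sval W [set x | forall y, good x y].
  apply: contrapT => /Uf_setC Wbad.
  have [x0 /existsNP [y0 _]] := Uf_ex Wbad.
  have /choice [y yP] : forall x, exists y, (exists y', ~ good x y') -> ~ good x y.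
    move=> x; have [[y' ny']|ny] := pselect (exists y', ~ good x y'); first by exists y'.
    by exists y0.
  pose t i := l (push (fun x => cat_env (y x) x i) W).
  have Wt : sval W [set x | coherent_on head body (cat_env (y x) x) t].
    exact: (@coherent_on_push M l _ W _ (fun x => cat_env (y x) x) lP).
  have [x [/existsNP /yP nx xt]] := Uf_disjoint Wbad Wt.
  apply: nx; exists (finfun t); split.
    move=> i; rewrite ffunE /t -Wp; congr (l (push _ _)).
    by apply/funext => z; rewrite cat_envr.
  by have -> : (finfun t : _ -> _) = t by apply/funext => i; rewrite ffunE.
have [x [x1 [x2 x3]]] := Uf_ex (filterI E1 (filterI E2 E3)).
exists x; split=> //.
  move=> a wa; have [i pi] := wp a wa; exists i; last by rewrite (x1 _ _ pi).
  by apply/asboolP; exists a.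
move=> i j /andP [/asboolP [a wa pa] /asboolP pij].
by rewrite (x1 i a pa); exact: x2 pa pij.
Qed.

End Realization.

(** * From the structure to the ultrafilter extension *)

Section Saturation.
Context {L K : finType} (head body : L -> K -> bool).
Context {M : structure} {n : nat}.
Hypothesis exceptional_finite : finite_set (@infinite_degree M).
Hypothesis degree_le : forall x : M, ~ infinite_degree x ->
  successors x #<= `I_n /\ predecessors x #<= `I_n.

(** Regular successors of a nonprincipal ultrafilter are determined by their
    colour; the other ones are principal at one of the finitely many
    exceptional points. *)
Lemma infinite_ue_successors (u : Uf M) :
  ~ finite_set [set v | ue_edge u v] ->
  exists2 a, u = point_Uf a & infinite_set (successors a).
Proof.
move=> uinf; have [/principalP [a ua]|np] := pselect (principal u).
  exists a => // afin; apply: uinf; apply: sub_finite_set (finite_image (@point_Uf M) afin).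
  move=> v; rewrite /= ua => /ue_edge_pointl /(Uf_finite_principal afin) [y ay ->].
  by exists y.
case: uinf; have ur := nonprincipal_regular exceptional_finite np.
have [d [c [cs _]]] := local_coloring degree_le.
have /choice [z zP] : forall i, exists z, forall v,
    [/\ ue_edge u v, sval v (~` @infinite_degree M) & sval v [set x | c x = i]] ->
    v = z.
  move=> i; apply: (bound_subsingleton u) => v w [uv vr cv] [uw wr cw].
  apply: contrapT => /Uf_sep [X [vX wX]].
  pose C := ~` @infinite_degree M `&` [set x | c x = i].
  have uX : sval u (dia (X `&` C)) by apply: uv; do 2 apply: filterI => //.
  have uY : sval u (dia (~` X `&` C)) by apply: uw; do 2 apply: filterI => //.
  have [x [rx [[y xy [Xy [ry cy]]] [y' xy' [nXy' [ry' cy']]]]]] :=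
    Uf_disjoint ur (filterI uX uY).
  by apply: nXy'; rewrite -(cs x y y') // cy.
apply: (@sub_finite_set _ _ (@point_Uf M @` @infinite_degree M `|` z @` setT)).
  move=> v uv; have [vi|/Uf_setC vr] := pselect (sval v (@infinite_degree M)).
    by left; have [b bi ->] := Uf_finite_principal exceptional_finite vi; exists b.
  right; have [i vi] := Uf_fiber v c; exists i => //.
  by rewrite -(zP i v).
by rewrite finite_setU; split; apply: finite_image => //; exact: finite_finset.
Qed.

(** The map is confined to large sets of points whose successors, like those of
    the ultrafilter [u], are divided among the colours of the successors of
    [u]. As [h v] is a regular successor of [h u] with the colour of [v], it is
    the only one of that colour. Edges with a principal end point are preserved because
    the successors, or predecessors, of a point form a set that can be made
    part of the requirement at the other end. *)
Lemma bounded_morphism_approximation (J : Type) (W : Uf J) k (x : 'I_k -> J -> M)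
    (m0 : M) (F : set (Uf M)) :
  (forall i, ~ principal (push (x i) W) -> ae_inj W (x i)) -> finite_set F ->
  sval W [set j | exists h : Uf M -> M,
    [/\ forall i, h (push (x i) W) = x i j,
        forall u v, F u -> F v -> ue_edge u v -> edge (h u) (h v) &
        forall u, F u -> (forall v, ue_edge u v -> F v) ->
          forall z, edge (h u) z -> exists v, [/\ F v, ue_edge u v & z = h v]]].
Proof.
move=> xi Ffin; have [d [c [cs _]]] := local_coloring degree_le.
pose G : set M := ~` @infinite_degree M.
have Greg u : ~ principal u -> sval u G := @nonprincipal_regular M exceptional_finite u.
have /choice [col colP] := fun u : Uf M => Uf_fiber u c.
(* The candidates for the image of [v]. *)
pose near_v (v : Uf M) (z : M) :=
  (exists2 b, v = point_Uf b & z = b) \/ [/\ ~ principal v, G z & c z = col v].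
have near_v_large v : sval v (near_v v).
  have [/principalP [b ->]|np] := pselect (principal v).
    by apply/point_UfE; left; exists b.
  by apply: filterS (filterI (Greg _ np) (colP v)) => z [Gz cz]; right.
pose U (u : Uf M) : set M := [set a | ~ principal u -> F u ->
  [/\ G a, c a = col u,
      forall v, F v -> forall b, v = point_Uf b ->
        (ue_edge v u -> edge b a) /\ (ue_edge u v -> edge a b) &
      (forall v, ue_edge u v -> F v) ->
        forall z, edge a z -> exists v, [/\ F v, ue_edge u v & near_v v z]]].
have Ularge u : sval u (U u).
  have [pu|npu] := pselect (principal u); first by apply: filterS filterT => a _ /(_ pu).
  have U3 : sval u [set a | forall v, F v -> forall b, v = point_Uf b ->
        (ue_edge v u -> edge b a) /\ (ue_edge u v -> edge a b)].
    apply: filter_finite_forall => // v Fv.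
    have [[b vb]|nv] := pselect (exists b, v = point_Uf b); last first.
      by apply: filterS filterT => a _ b vb; case: nv; exists b.
    have H1 : sval u [set a | ue_edge v u -> edge b a].
      have [vu|nvu] := pselect (ue_edge v u); last by apply: filterS filterT => a _ /nvu.
      have : sval u (successors b) by apply/ue_edge_pointl; rewrite -vb.
      by apply: filterS => a ba _.
    have H2 : sval u [set a | ue_edge u v -> edge a b].
      have [uv|nuv] := pselect (ue_edge u v); last by apply: filterS filterT => a _ /nuv.
      have : sval u (predecessors b) by apply/ue_edge_pointr; rewrite -vb.
      by apply: filterS => a ab _.
    apply: filterS (filterI H1 H2) => a [a1 a2] b'.
    by rewrite vb => /(@point_Uf_inj M) <-; rewrite -vb.
  have U4 : sval u [set a | (forall v, ue_edge u v -> F v) ->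
        forall z, edge a z -> exists v, [/\ F v, ue_edge u v & near_v v z]].
    have [uF|nuF] := pselect (forall v, ue_edge u v -> F v); last first.
      by apply: filterS filterT => a _ /nuF.
    apply: contrapT => /Uf_setC ubad.
    pose Z : set M := [set z | ~ exists v, [/\ F v, ue_edge u v & near_v v z]].
    have uZ : sval u (dia Z).
      apply: filterS ubad => a na; apply: contrapT => nZ; apply: na => _ z az.
      by apply: contrapT => nv; apply: nZ; exists z.
    have [v uv vZ] := ue_edge_ex uZ.
    have [z [nz]] := Uf_disjoint (near_v_large v) vZ.
    by apply; exists v; split=> //; exact: uF.
  apply: filterS (filterI (filterI (Greg _ npu) (colP u)) (filterI U3 U4)).
  by move=> a [[Ga ca] [a3 a4]] _ _; split.
have := approximation exceptional_finite degree_le m0 xi Ffin Ularge.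
apply: filterS => j [h [hpt hx hU hE]]; exists h.
have hedge u v : F u -> F v -> ue_edge u v -> edge (h u) (h v).
  move=> Fu Fv uv; have [/principalP [a ua]|npu] := pselect (principal u).
    have [/principalP [b vb]|npv] := pselect (principal v).
      by move: uv; rewrite ua vb !hpt => /ue_edge_pointl /point_UfE.
    have [_ _ /(_ u Fu a ua) [+ _] _] := hU v Fv npv npv Fv.
    by rewrite ua hpt -ua; apply.
  have [/principalP [b vb]|npv] := pselect (principal v).
    have [_ _ /(_ v Fv b vb) [_ +] _] := hU u Fu npu npu Fu.
    by rewrite vb hpt -vb; apply.
  exact: hE.
split=> // u Fu uF z uz.
have [/principalP [a ua]|npu] := pselect (principal u).
  have az : ue_edge u (point_Uf z).
    by rewrite ua; apply/ue_edge_pointl/point_UfE; move: uz; rewrite ua hpt.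
  by exists (point_Uf z); rewrite hpt; split=> //; exact: uF.
have [Gu _ _ /(_ uF z uz) [v [Fv uv vz]]] := hU u Fu npu npu Fu.
exists v; split=> //; case: vz => [[b -> ->]|[npv Gz cz]]; first by rewrite hpt.
have [Gv cv _ _] := hU v Fv npv npv Fv.
by apply: (cs (h u)) => //; [exact: hedge|rewrite cz cv].
Qed.

(** The labels of the images of [F] in [M], pulled back. An index [s] at least
    the size of [F] is taken, so that the images can be listed among the [s]
    further points that the tuple [X s] allows. *)
Lemma finite_labelling (W : Uf nat) k (hub : pred 'I_k) (C : rel 'I_k)
    (t : 'I_k -> L) N (X : nat -> 'I_k -> M) (i0 : 'I_k) (F : set (Uf M)) :
  (forall m, extendible head body hub C t N m (X m)) ->
  ~ principal W ->
  (forall i, ~ principal (push (X ^~ i) W) -> ae_inj W (X ^~ i)) ->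
  finite_set F ->
  exists l : Uf M -> L,
    [/\ forall i, l (push (X ^~ i) W) = t i,
        forall u v j, F u -> F v -> ue_edge u v -> body (l v) j -> head (l u) j &
        forall u j, F u -> (forall v, ue_edge u v -> F v) -> head (l u) j ->
          exists2 v, ue_edge u v & body (l v) j].
Proof.
move=> XP npW Xi Ffin; have [m [g gF]] := finite_enum Ffin.
have Wm : sval W [set s | m <= s].
  apply: contrapT => /Uf_setC Wlt; apply: npW.
  have [|s _ ->] := @Uf_finite_principal _ W `I_m (finite_II m).
    by apply: filterS Wlt => s /negP; rewrite -ltnNge.
  exact: principal_point.
have := bounded_morphism_approximation (X 0 i0) Xi Ffin.
move=> /(Uf_disjoint Wm) [s [ms [h [hX hE hB]]]].
pose y (i : 'I_s) := if insub (i : nat) is Some i' then h (g i') else X 0 i0.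
have [_ _ /(_ y) [l0 [l0t [l0eq l0U l0E]]]] := XP s.
set e := cat_env y (X s) in l0eq l0U l0E.
(* A position of each listed point; by coherence the choice does not affect
   its label. *)
have /choice [idx idxP] : forall b, exists i, (exists i', e i' = b) -> e i = b.
  move=> b; have [[i ib]|nb] := pselect (exists i, e i = b); first by exists i.
  by exists (rshift s i0).
have he u : F u -> e (idx (h u)) = h u.
  move=> /gF [i <-]; apply: idxP.
  exists (lshift k (widen_ord ms i)); rewrite /e cat_envl /y /= insubT //= => lt_im.
  by congr (h (g _)); exact: val_inj.
exists (fun u => l0 (idx (h u))); split.
- move=> i; rewrite -l0t; apply: l0eq; rewrite hX /e cat_envr -/e.
  by apply: idxP; exists (rshift s i); rewrite /e cat_envr.
- by move=> u v j Fu Fv uv; apply: l0U; rewrite !he //; exact: hE.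
- move=> u j Fu uF hj.
  have [|i [ui bi]] := l0E _ _ hj.
    move=> z; rewrite he // => /(hB u Fu uF) [v [Fv _ ->]].
    by exists (idx (h v)); rewrite he.
  have [v [Fv uv ev]] := hB u Fu uF _ (eq_ind _ (fun b => edge b (e i)) ui _ (he u Fu)).
  by exists v => //; rewrite (l0eq _ i) // he.
Qed.

(** Finite labellings converge to a coherent one: if [u] has finitely many
    successors, then [u] and its successors fit in a finite set; otherwise [u]
    is principal at a point which is an entry of every tuple, so [u] is a pin,
    and its witnesses are pins too. *)
Lemma coherent_ex k (hub : pred 'I_k) (C : rel 'I_k) (t : 'I_k -> L) N :
  'I_k ->
  (forall m, exists x : 'I_k -> M, extendible head body hub C t N m x) ->
  (forall i j, hub i -> head (t i) j -> exists2 i', C i i' & body (t i') j) ->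
  exists l : Uf M -> L, coherent head body l /\ forall i, exists v, l v = t i.
Proof.
move=> i0 /choice [X XP] hubP.
have [E Einf EP] := infinite_const_or_inj_family (fun i m => X m i).
have [W WE npW] := nonprincipal_ultrafilter_on Einf.
pose q i := push (X ^~ i) W.
have Xi i : ~ principal (q i) -> ae_inj W (X ^~ i).
  case: (EP i) => [[v vP]|injE _]; last by exists E.
  by case; exists v; rewrite pushE; apply: filterS WE => s /vP.
have /choice [lam lamP] : forall F : set (Uf M), exists l : Uf M -> L, finite_set F ->
    [/\ forall i, l (q i) = t i,
        forall u v j, F u -> F v -> ue_edge u v -> body (l v) j -> head (l u) j &
        forall u j, F u -> (forall v, ue_edge u v -> F v) -> head (l u) j ->
          exists2 v, ue_edge u v & body (l v) j].
  move=> F; have [Ffin|] := pselect (finite_set F); last by exists (fun=> t i0).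
  by have [l lP] := finite_labelling i0 XP npW Xi Ffin; exists l.
have [l lP] := finite_labelling_limit lam.
have lq i : l (q i) = t i.
  have [G [Gfin FG <-]] := lP _ (finite_set1 (q i)); last by [].
  by case: (lamP G Gfin).
exists l; split; last by move=> i; exists (q i).
move=> u j; split=> [hj|[v uv bj]]; last first.
  have [G [Gfin FG Gl]] := lP _ (finite_set2 u v).
  have [_ lU _] := lamP G Gfin.
  move: bj; rewrite -!Gl; [|by left|by right].
  by apply: lU => //; apply: FG; [left|right].
have [ufin|uinf] := pselect (finite_set [set v | ue_edge u v]).
  have [|G [Gfin FG Gl]] := lP (u |` [set v | ue_edge u v]).
    by rewrite finite_setU; split=> //; exact: finite_set1.
  have [_ _ lE] := lamP G Gfin.
  move: hj; rewrite -Gl; last by left.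
  case/lE; [by apply: FG; left|by move=> v uv; apply: FG; right|].
  by move=> v uv; rewrite Gl; [exists v|right].
have [a ua ainf] := infinite_ue_successors uinf.
(* The position of [a] may vary with the tuple, but is constant on a large set. *)
have /choice [hi hiP] : forall m, exists i, hub i /\ a = X m i.
  move=> m; have [H _ _] := XP m; have [i] := H a (wide_infinite N ainf).
  by exists i.
have [i Wi] := Uf_fiber W hi.
have [hubi _] : hub i /\ True by have [m <-] := Uf_ex Wi; case: (hiP m).
have uq : u = q i.
  rewrite ua; symmetry; apply: point_Uf_eq; rewrite pushE.
  by apply: filterS Wi => m /= <-; case: (hiP m).
rewrite uq lq in hj *; have [i' Cii' bi'] := hubP _ _ hubi hj.
exists (q i'); last by rewrite lq.
by apply: ue_edge_push; apply: filterS filterT => m _; have [_ + _] := XP m; apply.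
Qed.

End Saturation.

(** * Transfer of coherent labellings and of modal validity *)

(** The pins are [w], the points of large out-degree and one witness for each
    diamond at such a point. *)
Lemma coherent_transfer (L K : finType) (head body : L -> K -> bool)
    (A B : structure) (l : Uf A -> L) (w : Uf A) :
  almost_bounded A -> almost_bounded B -> elementarily_equivalent A B ->
  coherent head body l ->
  exists l' : Uf B -> L, coherent head body l' /\ exists v, l' v = l w.
Proof.
move=> [Afin [n degA]] [Bfin [n' degB]] AB lP.
have widefin : finite_set [set a : A | wide n.+1 a].
  by apply: sub_finite_set Afin => a; apply: wide_infinite_degree => /degA [].
have /choice [wit witP] : forall aj : A * K, exists v,
    head (l (point_Uf aj.1)) aj.2 -> ue_edge (point_Uf aj.1) v /\ body (l v) aj.2.
  move=> [a j]; have [/lP [v av bj]|nh] := pselect (head (l (point_Uf a)) j).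
    by exists v.
  by exists w.
pose pins : set (Uf A) := [set w] `|` (@point_Uf A @` [set a | wide n.+1 a] `|`
  wit @` ([set a | wide n.+1 a] `*` setT)).
have pinsfin : finite_set pins.
  rewrite !finite_setU; split; first exact: finite_set1.
  split; apply: finite_image => //.
  by apply: finite_setX => //; exact: finite_finset.
have [k [p pP]] := finite_enum pinsfin.
have [i0 i0w] : exists i, p i = w by apply/pP; left.
have wp (a : A) : wide n.+1 a -> exists i, p i = point_Uf a.
  by move=> wa; apply/pP; right; left; exists a.
have ext m : exists x : 'I_k -> B, extendible head body (hub_of n.+1 p)
    (hub_edge n.+1 p) (fun i => l (p i)) n.+1 m x.
  have := @extendible_ex L K head body A l n.+1 k p m lP wp.
  apply: (elementarily_equivalent_definable AB); exact: definable_extendible.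
have [|l' [l'P l't]] := coherent_ex Bfin degB i0 ext.
  move=> i j hi hj; have [a wa pa] := asboolW hi.
  rewrite pa in hj; have [aw bw] := witP (a, j) hj.
  have [i' pi'] : exists i', p i' = wit (a, j).
    by apply/pP; right; right; exists (a, j).
  exists i'; last by rewrite pi'.
  by rewrite /hub_edge hi pa pi' asboolT.
by exists l'; split=> //; have [v l'v] := l't i0; exists v; rewrite l'v i0w.
Qed.

Section Modal.
Context {P : Type}.

Fixpoint subformulas (phi : modal_formula P) : set (modal_formula P) :=
  [set phi] `|` match phi with
    | MVar _ | MBot => set0
    | MNeg psi | MDia psi => subformulas psi
    | MOr psi chi => subformulas psi `|` subformulas chi
    end.

Lemma finite_subformulas phi : finite_set (subformulas phi).
Proof.
elim: phi => [p||psi IH|psi IH chi IH'|psi IH] /=; rewrite ?finite_setU;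
  by do ?split => //; exact: finite_set1.
Qed.

Lemma subformulas_refl phi : subformulas phi phi.
Proof. by case: phi => *; left. Qed.

(** The truth values of the subformulas of [phi] under a refuting valuation form
    a coherent labelling. The labelling obtained over the other structure is
    read back as the valuation that makes a variable true where the label is
    that of a point at which the variable was true. *)
Lemma valid_transfer (A B : structure) (phi : modal_formula P) :
  almost_bounded A -> almost_bounded B -> elementarily_equivalent A B ->
  modal_valid (ultrafilter_extension B) phi ->
  modal_valid (ultrafilter_extension A) phi.
Proof.
move=> Ab Bb AB Bphi V w; apply: contrapT => nw.
have [n [g gP]] := finite_enum (finite_subformulas phi).
pose l0 (x : Uf A) : {ffun 'I_n * bool -> bool} := [ffun ib =>
  `[< @modal_true P (ultrafilter_extension A) V x (if ib.2 then MDia (g ib.1) else g ib.1) >]].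
(* Only labels that occur are kept: each is then the label of an actual point,
   so it respects the Boolean connectives. *)
pose L := {s : {ffun 'I_n * bool -> bool} | `[< exists x, l0 x = s >]}.
pose l (x : Uf A) : L := exist _ (l0 x) (asboolT (ex_intro _ x erefl)).
have lsurj (s : L) : exists x, l x = s.
  by have [x xs] := asboolW (valP s); exists x; exact: val_inj.
pose head (s : L) (i : 'I_n) := val s (i, true).
pose body (s : L) (i : 'I_n) := val s (i, false).
have headP x i : head (l x) i <-> @modal_true P (ultrafilter_extension A) V x (MDia (g i)).
  by rewrite /head /= ffunE; split=> [/asboolW|/asboolT].
have bodyP x i : body (l x) i <-> @modal_true P (ultrafilter_extension A) V x (g i).
  by rewrite /body /= ffunE; split=> [/asboolW|/asboolT].
have lP : coherent head body l.
  move=> u i; split=> [/headP [v /ue_edgeP uv /bodyP]|[v uv /bodyP vi]]; first by exists v.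
  by apply/headP; exists v => //; apply/ue_edgeP.
have [l' [l'P [v lv]]] := coherent_transfer w Ab Bb AB lP.
pose V' (p : P) : set (ultrafilter_extension B) :=
  [set y | exists2 x : Uf A, l x = l' y & V p x].
have truth psi : subformulas psi `<=` subformulas phi -> forall y x, l x = l' y ->
    (@modal_true P (ultrafilter_extension B) V' y psi <->
     @modal_true P (ultrafilter_extension A) V x psi).
  elim: psi => [p||psi IH|psi IH chi IH'|psi IH] /= sub y x xy.
  - split=> [[x' x'y Vx']|Vx]; last by exists x.
    have [i gi] : exists i, g i = MVar p by apply/gP/sub; left.
    have /bodyP : body (l x) i by rewrite xy -x'y; apply/bodyP; rewrite gi.
    by rewrite gi.
  - by [].
  - have H := IH (fun c cP => sub c (or_intror cP)) y x xy.
    by split=> nt /H.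
  - have H := IH (fun c cP => sub c (or_intror (or_introl cP))) y x xy.
    have H' := IH' (fun c cP => sub c (or_intror (or_intror cP))) y x xy.
    by split=> -[/H|/H']; [left|right|left|right].
  - have subpsi : subformulas psi `<=` subformulas phi by move=> c cP; apply: sub; right.
    have [i gi] : exists i, g i = psi by apply/gP/subpsi/subformulas_refl.
    have bodyB z : body (l' z) i <-> @modal_true P (ultrafilter_extension B) V' z psi.
      by have [x' x'z] := lsurj (l' z); rewrite -x'z bodyP gi (IH subpsi z x').
    have := headP x i; rewrite gi /= => <-; rewrite xy l'P.
    by split=> -[z /ue_edgeP yz /bodyB zi]; exists z.
apply: nw; rewrite -(truth phi _ v w) //; exact: Bphi.
Qed.

End Modal.

Theorem corollary2p20 (P : Type) (A B : structure) :
  almost_bounded A -> almost_bounded B ->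
  elementarily_equivalent A B ->
  modal_logic P (ultrafilter_extension A) =
  modal_logic P (ultrafilter_extension B).
Proof.
move=> Ab Bb AB; apply/seteqP; split=> phi.
  by apply: valid_transfer => // s; rewrite AB.
exact: valid_transfer.
Qed.
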